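(* Let $\Omega \subseteq \mathbb{C}$ be a convex domain and $F \subseteq \mathbb{N}_0$ be a non-empty set. Then $\mathcal{A}_{F}(\Omega)=\mathcal{A}_{\widetilde{F}_0}(\Omega)$ (as sets), where $\widetilde{F}_0=\{ l\in \mathbb{N}_0:0\leqslant l \leqslant \sup F\}$.
   Context: $\mathbb{N}_0=\{0,1,2,\dots\}$; $\sup F$ may be $+\infty$. For an open set $\Omega\subseteq\mathbb{C}$ and a non-empty set $F\subseteq\mathbb{N}_0$, $\mathcal{A}_F(\Omega)$ is the set of holomorphic functions $f$ on $\Omega$ such that the derivative $f^{(l)}$ has a continuous extension on $\overline{\Omega}$ for all $l\in F$, where the closure is taken in $\mathbb{C}$. *)

(* Defs.v *)
From Stdlib Require Import Reals.
From Coquelicot Require Import Coquelicot.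
Open Scope R_scope.

Definition closure (A : C -> Prop) : C -> Prop :=
  fun z => forall U : C -> Prop, locally z U -> exists w : C, U w /\ A w.

Definition is_connected (A : C -> Prop) : Prop :=
  forall U V : C -> Prop, open U -> open V ->
    (forall z, A z -> U z \/ V z) ->
    (exists z, A z /\ U z) -> (exists z, A z /\ V z) ->
    exists z, A z /\ U z /\ V z.

Definition is_domain (A : C -> Prop) : Prop :=
  open A /\ (exists z, A z) /\ is_connected A.

Definition is_convex (A : C -> Prop) : Prop :=
  forall (z w : C) (t : R), A z -> A w -> 0 <= t <= 1 ->
    A (RtoC (1 - t) * z + RtoC t * w)%C.

(* Differentiability here is over C: the scalars are [C_AbsRing]. *)
Definition holomorphic (f : C -> C) (Omega : C -> Prop) : Prop :=
  forall z, Omega z -> ex_derive (K := C_AbsRing) (V := C_NormedModule) f z.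

(* [C_derive] is total; it is the complex derivative wherever the function is
   complex differentiable ([C_derive_correct], [is_C_derive_unique]).  All
   derivatives of a holomorphic function are holomorphic, so on Omega no
   default value of [C_derive] is involved below. *)
Definition C_derive_n (f : C -> C) (l : nat) : C -> C := Nat.iter l C_derive f.

Definition has_continuous_extension (h : C -> C) (Omega : C -> Prop) : Prop :=
  exists g : C -> C,
    continuous_on (closure Omega) g /\ (forall z, Omega z -> g z = h z).

(* A function on an open set Omega is represented by a total function C -> C.
   Only its values on Omega matter: both conditions below are unchanged when
   [f] is modified outside of Omega. *)
Definition A_space (F : nat -> Prop) (Omega : C -> Prop) : (C -> C) -> Prop :=
  fun f => holomorphic f Omega /\
    forall l : nat, F l -> has_continuous_extension (C_derive_n f l) Omega.

(* The supremum is taken in [Rbar]; it is [p_infty] when F is unbounded. *)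
Definition sup_nat (F : nat -> Prop) : Rbar :=
  Lub_Rbar (fun x : R => exists l : nat, F l /\ x = INR l).

Definition F_tilde0 (F : nat -> Prop) : nat -> Prop :=
  fun l => Rbar_le (Finite (INR l)) (sup_nat F).

(* Main.v *)
Require Import Defs.
From Stdlib Require Import Reals.
From Coquelicot Require Import Coquelicot.
From Stdlib Require Import Lra Lia Classical ClassicalEpsilon.
Open Scope R_scope.

(* If [h] is holomorphic on the convex set [Omega] and [h'] extends
   continuously to the closure, then [h'] is bounded near each point of the
   closure, so by the mean value inequality [h] is Lipschitz on [Omega]
   intersected with a small disc, hence has a limit there; these limits form a
   continuous extension of [h].  One therefore descends from an element [m] of
   [F] to every [l <= m].  That all derivatives of [f] are again holomorphic is
   the classical theorem: Goursat for rectangles by bisection, then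
   [f p * G p = RectInt (f w / (w - p))] with [G p = RectInt (1 / (w - p))]
   nonzero, and differentiation under the integral sign.  Working with the
   quotient of the two integrals avoids computing [G p = 2 i pi]. *)

(** * Complex differentiability and continuity *)

(** The closure of [Omega] may be unbounded, so continuity of the extension of [h'] bounds it only
    locally; hence the Lipschitz estimate on discs, whose intersection with [Omega] stays convex. An
    unbounded [F] is no separate case: since [F] consists of integers, every l <= sup F lies below
    some element of [F]. The descent passes through all the intermediate derivatives of [f], and
    since [C_derive] is total, it is their holomorphy that makes each one the genuine derivative of
    the preceding one. Rectangles suit the Cauchy theory because their boundary integrals are real
    integrals over segments and bisection preserves their shape. *)

Notation is_cderive f z l :=
  (is_derive (K := C_AbsRing) (V := C_NormedModule) f z l).
Notation ex_cderive f z :=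
  (ex_derive (K := C_AbsRing) (V := C_NormedModule) f z).
Notation ccontinuous f z :=
  (continuous (T := C_UniformSpace) (U := C_UniformSpace) f z).

Lemma Cmod_le_Rabs (z : C) : Cmod z <= Rabs (fst z) + Rabs (snd z).
Proof.
  unfold Cmod.
  rewrite <- (sqrt_Rsqr (Rabs (fst z) + Rabs (snd z))).
  2: { generalize (Rabs_pos (fst z)) (Rabs_pos (snd z)); lra. }
  apply sqrt_le_1_alt. unfold Rsqr.
  rewrite <- (pow2_abs (fst z)), <- (pow2_abs (snd z)).
  generalize (Rabs_pos (fst z)) (Rabs_pos (snd z)); intros. nra.
Qed.

Lemma Rabs_fst_le_Cmod (z : C) : Rabs (fst z) <= Cmod z.
Proof. eapply Rle_trans; [apply Rmax_l | apply Rmax_Cmod]. Qed.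

Lemma Rabs_snd_le_Cmod (z : C) : Rabs (snd z) <= Cmod z.
Proof. eapply Rle_trans; [apply Rmax_r | apply Rmax_Cmod]. Qed.

(** The uniform structure of [C] is that of a product, so its balls are squares; this trades them
    for discs. *)
Lemma locally_C_iff (z : C) (P : C -> Prop) :
  locally (T := C_UniformSpace) z P <->
  exists d : R, 0 < d /\ forall w : C, Cmod (w - z) < d -> P w.
Proof.
  split.
  - intros [e He]. exists e. split; [apply cond_pos|].
    intros w Hw. apply He. apply C_NormedModule_mixin_compat1. exact Hw.
  - intros [d [Hd H]].
    assert (Hd2 : 0 < d / 2) by lra.
    exists (mkposreal _ Hd2). intros w Hw. apply H.
    eapply Rle_lt_trans; [apply Cmod_le_Rabs|].
    destruct Hw as [H1 H2]. 
    change (Rabs (fst w - fst z) < d / 2) in H1.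
    change (Rabs (snd w - snd z) < d / 2) in H2.
    simpl. unfold Rminus in *. lra.
Qed.

(** The filter inside [is_derive] comes from the modulus of [C_AbsRing], while continuity uses the
    product structure; [locally_C] identifies the two. *)
Lemma is_cderive_iff (f : C -> C) (z l : C) :
  is_cderive f z l <->
  forall e : R, 0 < e -> exists d : R, 0 < d /\ forall w : C,
    Cmod (w - z) < d -> Cmod (f w - f z - (w - z) * l) <= e * Cmod (w - z).
Proof.
  split.
  - intros [_ H] e He.
    specialize (H z (fun P HP => HP) (mkposreal e He)).
    apply locally_C in H. apply locally_C_iff in H. exact H.
  - intros H. split; [apply is_linear_scal_l|].
    intros x Hx e.
    (* The definition of differentiability quantifies over all limits [x] of the filter at [z];
       limits are unique. *)
    assert (x = z) as ->.
    { symmetry; apply (is_filter_lim_locally_unique (V := AbsRing_NormedModule C_AbsRing)); exact Hx. }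
    destruct (H e (cond_pos e)) as [d [Hd H']].
    apply locally_C. apply locally_C_iff. exists d. split; [exact Hd|].
    exact H'.
Qed.

Lemma ex_cderive_continuous (f : C -> C) (z : C) :
  ex_cderive f z -> ccontinuous f z.
Proof.
  intros H. apply ex_derive_continuous in H.
  intros P HP. 
  apply locally_C. apply H. exact HP.
Qed.

Lemma ccontinuous_iff (f : C -> C) (z : C) :
  ccontinuous f z <->
  forall e : R, 0 < e -> exists d : R, 0 < d /\ forall w : C,
    Cmod (w - z) < d -> Cmod (f w - f z) < e.
Proof.
  split.
  - intros H e He. apply locally_C_iff. apply (H (fun y => Cmod (y - f z) < e)).
    apply locally_C_iff. exists e; split; auto.
  - intros H P HP. apply locally_C_iff in HP. destruct HP as [e [He HP]].
    destruct (H e He) as [d [Hd H']]. apply locally_C_iff. exists d; split; auto.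
Qed.

Section Continuity.
Context {T : UniformSpace}.
Implicit Types f g : T -> C.

Lemma continuous_C_iff f x :
  continuous (U := C_UniformSpace) f x <->
  continuous (fun t => fst (f t)) x /\ continuous (fun t => snd (f t)) x.
Proof.
  split.
  - intros H. split; (eapply continuous_comp; [exact H|]).
    + destruct (f x); apply continuous_fst.
    + destruct (f x); apply continuous_snd.
  - intros [H1 H2] P [e He].
    assert (H1' := proj1 (filterlim_locally _ _) H1 e).
    assert (H2' := proj1 (filterlim_locally _ _) H2 e).
    unfold filtermap. generalize (filter_and _ _ H1' H2'). apply filter_imp.
    intros t Ht. apply He. exact Ht.
Qed.

Lemma continuous_Cplus f g x :
  continuous (U := C_UniformSpace) f x -> continuous (U := C_UniformSpace) g x ->
  continuous (U := C_UniformSpace) (fun t => f t + g t)%C x.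
Proof.
  rewrite !continuous_C_iff; intros [H1 H2] [H3 H4]; split; simpl.
  - apply (continuous_plus (V := R_NormedModule)); assumption.
  - apply (continuous_plus (V := R_NormedModule)); assumption.
Qed.

Lemma continuous_Copp f x :
  continuous (U := C_UniformSpace) f x ->
  continuous (U := C_UniformSpace) (fun t => - f t)%C x.
Proof.
  rewrite !continuous_C_iff; intros [H1 H2]; split; simpl.
  - apply (continuous_opp (V := R_NormedModule)); assumption.
  - apply (continuous_opp (V := R_NormedModule)); assumption.
Qed.

Lemma continuous_Cminus f g x :
  continuous (U := C_UniformSpace) f x -> continuous (U := C_UniformSpace) g x ->
  continuous (U := C_UniformSpace) (fun t => f t - g t)%C x.
Proof. intros Hf Hg; apply continuous_Cplus; [|apply continuous_Copp]; assumption. Qed.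

Lemma continuous_Cmult f g x :
  continuous (U := C_UniformSpace) f x -> continuous (U := C_UniformSpace) g x ->
  continuous (U := C_UniformSpace) (fun t => f t * g t)%C x.
Proof.
  rewrite !continuous_C_iff; intros [H1 H2] [H3 H4]; split; simpl.
  - apply (continuous_minus (V := R_NormedModule)); apply (continuous_mult (K := R_AbsRing)); assumption.
  - apply (continuous_plus (V := R_NormedModule)); apply (continuous_mult (K := R_AbsRing)); assumption.
Qed.

Lemma continuous_Cinv f x :
  f x <> 0%C -> continuous (U := C_UniformSpace) f x ->
  continuous (U := C_UniformSpace) (fun t => / f t)%C x.
Proof.
  rewrite !continuous_C_iff; intros H0 [H1 H2].
  (* The form [x * (x * 1)] is what [simpl] makes of the squares in [Cinv]. *)
  assert (Hd : continuous (fun t => / (fst (f t) * (fst (f t) * 1) + snd (f t) * (snd (f t) * 1))) x).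
  { apply (continuous_comp _ Rinv).
    - apply (continuous_plus (V := R_NormedModule)).
      + apply (continuous_mult (K := R_AbsRing)); [assumption|].
        apply (continuous_mult (K := R_AbsRing)); [assumption | apply continuous_const].
      + apply (continuous_mult (K := R_AbsRing)); [assumption|].
        apply (continuous_mult (K := R_AbsRing)); [assumption | apply continuous_const].
    - apply continuous_Rinv. intros E. apply H0.
      destruct (f x) as [u v]; simpl in E. unfold RtoC. f_equal; nra. }
  split; simpl.
  - apply (continuous_mult (K := R_AbsRing)); assumption.
  - apply (continuous_mult (K := R_AbsRing)); [apply (continuous_opp (V := R_NormedModule))|]; assumption.
Qed.

End Continuity.

(** * Integrals of complex-valued functions over a real segment *)

(** Taken componentwise, so that every property reduces to one of the real [RInt]. *)
Definition CInt (g : R -> C) (a b : R) : C :=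
  (RInt (fun t => fst (g t)) a b, RInt (fun t => snd (g t)) a b).

Definition continuous_seg (g : R -> C) (a b : R) : Prop :=
  forall t, a <= t <= b -> continuous (U := C_UniformSpace) g t.

Section Integral.
Variables (a b : R).
Hypothesis Hab : a <= b.

Lemma ex_RInt_fst g : continuous_seg g a b -> ex_RInt (fun t => fst (g t)) a b.
Proof.
  intros H. apply (ex_RInt_continuous (V := R_CompleteNormedModule)).
  rewrite Rmin_left, Rmax_right by assumption. intros z Hz.
  exact (proj1 (proj1 (continuous_C_iff g z) (H z Hz))).
Qed.

Lemma ex_RInt_snd g : continuous_seg g a b -> ex_RInt (fun t => snd (g t)) a b.
Proof.
  intros H. apply (ex_RInt_continuous (V := R_CompleteNormedModule)).
  rewrite Rmin_left, Rmax_right by assumption. intros z Hz.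
  exact (proj2 (proj1 (continuous_C_iff g z) (H z Hz))).
Qed.

Lemma CInt_ext g h : (forall t, a <= t <= b -> g t = h t) -> CInt g a b = CInt h a b.
Proof.
  intros H. unfold CInt. f_equal; apply RInt_ext;
  rewrite Rmin_left, Rmax_right by assumption; intros x Hx; rewrite H; auto; lra.
Qed.

Lemma CInt_const (c : C) : CInt (fun _ => c) a b = (RtoC (b - a) * c)%C.
Proof.
  unfold CInt. rewrite !RInt_const. destruct c as [u v].
  unfold RtoC, Cmult; simpl. unfold scal; simpl; unfold mult; simpl.
  f_equal; ring.
Qed.

Lemma CInt_scal g (c : C) : continuous_seg g a b ->
  CInt (fun t => c * g t)%C a b = (c * CInt g a b)%C.
Proof.
  intros Hg. destruct c as [u v]. 
  assert (E1 := ex_RInt_fst _ Hg). assert (E2 := ex_RInt_snd _ Hg).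
  unfold CInt, Cmult; simpl. f_equal.
  - rewrite (RInt_minus (V := R_CompleteNormedModule) (fun t => u * fst (g t)) (fun t => v * snd (g t))).
    + rewrite (RInt_scal (V := R_CompleteNormedModule) (fun t => fst (g t))), (RInt_scal (V := R_CompleteNormedModule) (fun t => snd (g t))); auto.
    + apply (ex_RInt_scal (V := R_CompleteNormedModule)); auto.
    + apply (ex_RInt_scal (V := R_CompleteNormedModule)); auto.
  - rewrite (RInt_plus (V := R_CompleteNormedModule) (fun t => u * snd (g t)) (fun t => v * fst (g t))).
    + rewrite (RInt_scal (V := R_CompleteNormedModule) (fun t => fst (g t))), (RInt_scal (V := R_CompleteNormedModule) (fun t => snd (g t))); auto.
    + apply (ex_RInt_scal (V := R_CompleteNormedModule)); auto.
    + apply (ex_RInt_scal (V := R_CompleteNormedModule)); auto.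
Qed.

Lemma CInt_minus g h : continuous_seg g a b -> continuous_seg h a b ->
  CInt (fun t => g t - h t)%C a b = (CInt g a b - CInt h a b)%C.
Proof.
  intros Hg Hh. unfold CInt, Cminus, Cplus, Copp; simpl. f_equal.
  - apply (RInt_minus (V := R_CompleteNormedModule)); apply ex_RInt_fst; assumption.
  - apply (RInt_minus (V := R_CompleteNormedModule)); apply ex_RInt_snd; assumption.
Qed.

(** The factor 2 comes from bounding the real and the imaginary part separately. *)
Lemma CInt_bound g (M : R) : continuous_seg g a b ->
  (forall t, a <= t <= b -> Cmod (g t) <= M) ->
  Cmod (CInt g a b) <= 2 * (b - a) * M.
Proof.
  intros Hg HM.
  eapply Rle_trans; [apply Cmod_le_Rabs|]. unfold CInt; simpl.
  assert (Rabs (RInt (fun t => fst (g t)) a b) <= (b - a) * M).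
  { apply abs_RInt_le_const; auto. apply ex_RInt_fst; auto.
    intros t Ht. eapply Rle_trans; [apply Rabs_fst_le_Cmod | auto]. }
  assert (Rabs (RInt (fun t => snd (g t)) a b) <= (b - a) * M).
  { apply abs_RInt_le_const; auto. apply ex_RInt_snd; auto.
    intros t Ht. eapply Rle_trans; [apply Rabs_snd_le_Cmod | auto]. }
  lra.
Qed.

End Integral.

Lemma CInt_Chasles (g : R -> C) (a b c : R) : a <= b <= c -> continuous_seg g a c ->
  (CInt g a b + CInt g b c)%C = CInt g a c.
Proof.
  intros [Hab Hbc] Hg.
  assert (H1 : continuous_seg g a b) by (intros t Ht; apply Hg; lra).
  assert (H2 : continuous_seg g b c) by (intros t Ht; apply Hg; lra).
  unfold CInt, Cplus; simpl; f_equal; apply (RInt_Chasles (V := R_CompleteNormedModule)).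
  - exact (ex_RInt_fst a b Hab g H1).
  - exact (ex_RInt_fst b c Hbc g H2).
  - exact (ex_RInt_snd a b Hab g H1).
  - exact (ex_RInt_snd b c Hbc g H2).
Qed.

(** * Goursat's theorem for rectangles *)

Definition rectangle (a b c d : R) (z : C) : Prop :=
  a <= fst z <= b /\ c <= snd z <= d.

Definition rectangle_boundary (a b c d : R) (z : C) : Prop :=
  rectangle a b c d z /\ (fst z = a \/ fst z = b \/ snd z = c \/ snd z = d).

(** The contour integral of f dz along the boundary, counterclockwise: bottom minus top, then right
    minus left with dz = i dy. *)
Definition RectInt (f : C -> C) (a b c d : R) : C :=
  (CInt (fun x => f (x, c)) a b - CInt (fun x => f (x, d)) a b
   + Ci * (CInt (fun y => f (b, y)) c d - CInt (fun y => f (a, y)) c d))%C.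

Lemma ccontinuous_horizontal (f : C -> C) (x y : R) :
  ccontinuous f (x, y) -> continuous (U := C_UniformSpace) (fun t => f (t, y)) x.
Proof.
  intros H. apply (continuous_comp (fun t : R => (t, y) : C_UniformSpace) f); [|exact H].
  apply continuous_C_iff; split; simpl; [apply continuous_id | apply continuous_const].
Qed.

Lemma ccontinuous_vertical (f : C -> C) (x y : R) :
  ccontinuous f (x, y) -> continuous (U := C_UniformSpace) (fun t => f (x, t)) y.
Proof.
  intros H. apply (continuous_comp (fun t : R => (x, t) : C_UniformSpace) f); [|exact H].
  apply continuous_C_iff; split; simpl; [apply continuous_const | apply continuous_id].
Qed.

Section Edges.
Variables (a b c d : R) (f : C -> C).
Hypotheses (Hab : a <= b) (Hcd : c <= d).
Hypothesis Hf : forall z, rectangle_boundary a b c d z -> ccontinuous f z.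

Lemma continuous_edges :
  continuous_seg (fun x => f (x, c)) a b /\ continuous_seg (fun x => f (x, d)) a b /\
  continuous_seg (fun y => f (b, y)) c d /\ continuous_seg (fun y => f (a, y)) c d.
Proof.
  repeat split; intros t Ht;
    (apply ccontinuous_horizontal || apply ccontinuous_vertical); apply Hf;
    split; try split; simpl; try lra; tauto.
Qed.
End Edges.

Section Linear.
Variables (a b c d : R).
Hypotheses (Hab : a <= b) (Hcd : c <= d).

Lemma RectInt_minus f g :
  (forall z, rectangle_boundary a b c d z -> ccontinuous f z) ->
  (forall z, rectangle_boundary a b c d z -> ccontinuous g z) ->
  RectInt (fun z => f z - g z)%C a b c d = (RectInt f a b c d - RectInt g a b c d)%C.
Proof.
  intros Hf Hg.
  destruct (continuous_edges a b c d f Hab Hcd Hf) as (F1 & F2 & F3 & F4).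
  destruct (continuous_edges a b c d g Hab Hcd Hg) as (G1 & G2 & G3 & G4).
  unfold RectInt.
  rewrite (CInt_minus a b Hab (fun x => f (x, c)) (fun x => g (x, c))),
    (CInt_minus a b Hab (fun x => f (x, d)) (fun x => g (x, d))),
    (CInt_minus c d Hcd (fun y => f (b, y)) (fun y => g (b, y))),
    (CInt_minus c d Hcd (fun y => f (a, y)) (fun y => g (a, y))); auto.
  ring.
Qed.

Lemma RectInt_scal f k :
  (forall z, rectangle_boundary a b c d z -> ccontinuous f z) ->
  RectInt (fun z => k * f z)%C a b c d = (k * RectInt f a b c d)%C.
Proof.
  intros Hf.
  destruct (continuous_edges a b c d f Hab Hcd Hf) as (F1 & F2 & F3 & F4).
  unfold RectInt.
  rewrite (CInt_scal a b Hab (fun x => f (x, c))),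
    (CInt_scal a b Hab (fun x => f (x, d))),
    (CInt_scal c d Hcd (fun y => f (b, y))),
    (CInt_scal c d Hcd (fun y => f (a, y))); auto.
  ring.
Qed.

(** The perimeter is 2 ((b - a) + (d - c)); the other factor 2 is that of [CInt_bound]. *)
Lemma RectInt_bound f M :
  (forall z, rectangle_boundary a b c d z -> ccontinuous f z) ->
  (forall z, rectangle_boundary a b c d z -> Cmod (f z) <= M) ->
  Cmod (RectInt f a b c d) <= 4 * ((b - a) + (d - c)) * M.
Proof.
  intros Hf HM.
  destruct (continuous_edges a b c d f Hab Hcd Hf) as (F1 & F2 & F3 & F4).
  apply (CInt_bound _ _ Hab _ M) in F1, F2;
    [apply (CInt_bound _ _ Hcd _ M) in F3, F4 | |];
    try (intros t Ht; apply HM; split; try split; simpl; try lra; tauto).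
  unfold RectInt.
  eapply Rle_trans; [apply Cmod_triangle|]. rewrite Cmod_mult, Cmod_Ci.
  unfold Cminus.
  assert (T := Cmod_triangle (CInt (fun x => f (x, c)) a b) (- CInt (fun x => f (x, d)) a b)).
  assert (U := Cmod_triangle (CInt (fun y => f (b, y)) c d) (- CInt (fun y => f (a, y)) c d)).
  rewrite Cmod_opp in T, U. lra.
Qed.

(** On opposite edges the values differ by a constant: - l i (d - c) between bottom and top, l (b -
    a) between right and left. The two contributions cancel. *)
Lemma RectInt_affine (k l : C) : RectInt (fun z => k + l * z)%C a b c d = 0%C.
Proof.
  assert (H : forall z, rectangle_boundary a b c d z -> ccontinuous (fun z => k + l * z)%C z).
  { intros z _. apply continuous_Cplus; [apply continuous_const|].
    apply continuous_Cmult; [apply continuous_const | apply continuous_id]. }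
  destruct (continuous_edges a b c d _ Hab Hcd H) as (F1 & F2 & F3 & F4).
  unfold RectInt. rewrite <- (CInt_minus a b Hab) by assumption.
  rewrite <- (CInt_minus c d Hcd) by assumption.
  rewrite (CInt_ext a b Hab _ (fun _ => - (l * Ci * RtoC (d - c)))%C).
  2: { intros t _. destruct l, k. apply injective_projections; simpl; ring. }
  rewrite (CInt_ext c d Hcd _ (fun _ => l * RtoC (b - a))%C).
  2: { intros t _. destruct l, k. apply injective_projections; simpl; ring. }
  rewrite !CInt_const. ring.
Qed.

End Linear.

(** The common edge is traversed in both directions and cancels; the horizontal edges
    concatenate. *)
Lemma RectInt_split_vertical f (a m b c d : R) : a <= m <= b -> c <= d ->
  (forall x, a <= x <= b -> ccontinuous f (x, c) /\ ccontinuous f (x, d)) ->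
  RectInt f a b c d = (RectInt f a m c d + RectInt f m b c d)%C.
Proof.
  intros Hm Hcd Hf. unfold RectInt.
  rewrite <- (CInt_Chasles (fun x => f (x, c)) a m b),
    <- (CInt_Chasles (fun x => f (x, d)) a m b); auto;
    try (intros t Ht; apply ccontinuous_horizontal; apply Hf; auto).
  ring.
Qed.

Lemma RectInt_split_horizontal f (a b c m d : R) : a <= b -> c <= m <= d ->
  (forall y, c <= y <= d -> ccontinuous f (a, y) /\ ccontinuous f (b, y)) ->
  RectInt f a b c d = (RectInt f a b c m + RectInt f a b m d)%C.
Proof.
  intros Hm Hcd Hf. unfold RectInt.
  rewrite <- (CInt_Chasles (fun y => f (b, y)) c m d),
    <- (CInt_Chasles (fun y => f (a, y)) c m d); auto;
    try (intros t Ht; apply ccontinuous_vertical; apply Hf; auto).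
  ring.
Qed.

(** The point is the supremum of the left ends, since every left end lies below every right end. *)
Lemma nested_intervals (u : nat -> R) (L : R) :
  0 <= L ->
  (forall n, u n <= u (S n) /\ u (S n) + L / 2 ^ S n <= u n + L / 2 ^ n) ->
  exists X, forall n, u n <= X <= u n + L / 2 ^ n.
Proof.
  intros HL Hu.
  assert (Hpos : forall n, 0 <= L / 2 ^ n).
  { intros n. apply Rmult_le_pos; [exact HL|]. left. apply Rinv_0_lt_compat, pow_lt; lra. }
  assert (Hmono : forall n k, u n <= u (k + n)%nat /\
            u (k + n)%nat + L / 2 ^ (k + n) <= u n + L / 2 ^ n).
  { intros n k; induction k as [|k IH]; simpl (_ + _)%nat; [lra|].
    specialize (Hu (k + n)%nat). lra. }
  assert (Hle : forall n m, u m <= u n + L / 2 ^ n).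
  { intros n m. destruct (Nat.le_ge_cases n m) as [H|H].
    - replace m with ((m - n) + n)%nat by lia.
      generalize (Hmono n (m - n)%nat) (Hpos (m - n + n)%nat). lra.
    - replace n with ((n - m) + m)%nat by lia.
      generalize (Hmono m (n - m)%nat) (Hpos (n - m + m)%nat). lra. }
  destruct (completeness (fun x => exists n, x = u n)) as [X [HX1 HX2]].
  - exists (u 0%nat + L / 2 ^ 0). intros x [n ->]. apply Hle.
  - exists (u 0%nat), 0%nat. reflexivity.
  - exists X. intros n; split.
    + apply HX1. exists n; reflexivity.
    + apply HX2. intros x [m ->]. apply Hle.
Qed.

(** The integral is the sum over the four quarters, so one of them carries at least a quarter of the
    modulus. The quarter is given by its lower left corner, because in the iteration the side
    lengths depend only on the step. *)
Lemma RectInt_quarter (f : C -> C) (a b c d K : R) : a <= b -> c <= d ->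
  (forall z, rectangle a b c d z -> ccontinuous f z) ->
  K <= Cmod (RectInt f a b c d) ->
  exists x y, (x = a \/ x = (a + b) / 2) /\ (y = c \/ y = (c + d) / 2) /\
    K / 4 <= Cmod (RectInt f x (x + (b - a) / 2) y (y + (d - c) / 2)).
Proof.
  intros Hab Hcd Hf HK.
  set (m := (a + b) / 2). set (n := (c + d) / 2).
  assert (Hm : a <= m <= b) by (unfold m; lra).
  assert (Hn : c <= n <= d) by (unfold n; lra).
  assert (E : RectInt f a b c d =
    (RectInt f a m c n + RectInt f a m n d + (RectInt f m b c n + RectInt f m b n d))%C).
  { rewrite (RectInt_split_vertical f a m b c d); auto.
    2: intros x Hx; split; apply Hf; split; simpl; lra.
    rewrite (RectInt_split_horizontal f a m c n d), (RectInt_split_horizontal f m b c n d);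
      try reflexivity; try lra;
      intros y Hy; split; apply Hf; split; simpl; lra. }
  assert (T := Cmod_triangle (RectInt f a m c n + RectInt f a m n d) (RectInt f m b c n + RectInt f m b n d)).
  assert (T1 := Cmod_triangle (RectInt f a m c n) (RectInt f a m n d)).
  assert (T2 := Cmod_triangle (RectInt f m b c n) (RectInt f m b n d)).
  rewrite <- E in T.
  replace m with (a + (b - a) / 2) in T1 by (unfold m; lra).
  replace b with (m + (b - a) / 2) in T2 by (unfold m; lra).
  assert (Ea : a + (b - a) / 2 = m) by (unfold m; lra).
  assert (Eb : m + (b - a) / 2 = b) by (unfold m; lra).
  assert (Ec : c + (d - c) / 2 = n) by (unfold n; lra).
  assert (Ed : n + (d - c) / 2 = d) by (unfold n; lra).
  rewrite ?Ea, ?Eb in *.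
  destruct (Rle_lt_dec (K / 4) (Cmod (RectInt f a m c n))) as [H|H1].
  { exists a, c. rewrite Ea, Ec. tauto. }
  destruct (Rle_lt_dec (K / 4) (Cmod (RectInt f a m n d))) as [H|H2].
  { exists a, n. rewrite Ea, Ed. tauto. }
  destruct (Rle_lt_dec (K / 4) (Cmod (RectInt f m b c n))) as [H|H3].
  { exists m, c. rewrite Eb, Ec. tauto. }
  destruct (Rle_lt_dec (K / 4) (Cmod (RectInt f m b n d))) as [H|H4].
  { exists m, n. rewrite Eb, Ed. tauto. }
  exfalso; lra.
Qed.

(** Bisection only asserts that a good quarter exists; this turns it into a sequence. Choice is
    applied to pairs (n, x), with [x] itself as a default where [P] fails. *)
Lemma dependent_choice_nat {X : Type} (P : nat -> X -> Prop) (Q : nat -> X -> X -> Prop) (x0 : X) :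
  P 0%nat x0 -> (forall n x, P n x -> exists y, P (S n) y /\ Q n x y) ->
  exists u : nat -> X, forall n, P n (u n) /\ Q n (u n) (u (S n)).
Proof.
  intros H0 Hstep.
  destruct (choice (fun (nx : nat * X) y => P (fst nx) (snd nx) ->
              P (S (fst nx)) y /\ Q (fst nx) (snd nx) y)) as [s Hs].
  { intros [n x]. destruct (classic (P n x)) as [H|H].
    - destruct (Hstep n x H) as [y Hy]. exists y; auto.
    - exists x; intros H'; contradiction. }
  set (u := fix u (n : nat) : X := match n with O => x0 | S m => s (m, u m) end).
  assert (Hu : forall n, P n (u n)).
  { induction n as [|n IH]; [exact H0|]. apply (Hs (n, u n) IH). }
  exists u. intros n; split; [apply Hu|]. apply (Hs (n, u n) (Hu n)).
Qed.

(** If the integral had modulus K > 0, the n-th nested rectangle would carry at least K / 4^n. Near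
    the common point, [f] differs from its affine tangent, whose integral vanishes, by a small
    multiple of the distance; distance and perimeter are both of order 2^-n, so the integral is a
    small multiple of 4^-n. *)
Theorem Goursat (f : C -> C) (a b c d : R) : a <= b -> c <= d ->
  (forall z, rectangle a b c d z -> ex_cderive f z) ->
  RectInt f a b c d = 0%C.
Proof.
  intros Hab Hcd Hf.
  assert (Hc : forall z, rectangle a b c d z -> ccontinuous f z)
    by (intros z Hz; apply ex_cderive_continuous, Hf, Hz).
  apply Cmod_eq_0.
  set (K := Cmod (RectInt f a b c d)).
  destruct (Rle_lt_or_eq_dec 0 K (Cmod_ge_0 _)) as [HK|HK]; [exfalso | now symmetry].
  set (s := b - a). set (t := d - c).
  assert (Hp : forall n, 0 < 2 ^ n) by (intros; apply pow_lt; lra).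
  assert (Hs : forall n, 0 <= s / 2 ^ n).
  { intros n; apply Rdiv_le_0_compat; [unfold s; lra | apply Hp]. }
  assert (Ht : forall n, 0 <= t / 2 ^ n).
  { intros n; apply Rdiv_le_0_compat; [unfold t; lra | apply Hp]. }
  assert (Hhalf : forall r n, r / 2 ^ S n = r / 2 ^ n / 2).
  { intros r n; simpl; field. specialize (Hp n); lra. }
  (* A state is the lower left corner of the n-th rectangle; [P] is the invariant and [Q] says that
     the rectangles are nested. *)
  destruct (dependent_choice_nat
    (fun n (p : R * R) => (a <= fst p /\ fst p + s / 2 ^ n <= b) /\
        (c <= snd p /\ snd p + t / 2 ^ n <= d) /\
        K / 4 ^ n <= Cmod (RectInt f (fst p) (fst p + s / 2 ^ n) (snd p) (snd p + t / 2 ^ n)))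
    (fun n p q => (fst p <= fst q /\ fst q + s / 2 ^ S n <= fst p + s / 2 ^ n) /\
        (snd p <= snd q /\ snd q + t / 2 ^ S n <= snd p + t / 2 ^ n))
    (a, c)) as [u Hu].
  { simpl. unfold s, t. unfold Rdiv; rewrite !Rinv_1, !Rmult_1_r.
    replace (a + (b - a)) with b by ring. replace (c + (d - c)) with d by ring.
    repeat split; try lra. apply Rle_refl. }
  { intros n [x y] (H1 & H2 & H3). simpl fst in *. simpl snd in *.
    destruct (RectInt_quarter f x (x + s / 2 ^ n) y (y + t / 2 ^ n) (K / 4 ^ n))
      as (x' & y' & Hx & Hy & H); auto.
    - specialize (Hs n); lra.
    - specialize (Ht n); lra.
    - intros z [Hz1 Hz2]. apply Hc. split; lra.
    - exists (x', y'). simpl fst; simpl snd.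
      replace (x + s / 2 ^ n - x) with (s / 2 ^ n) in H by ring.
      replace (y + t / 2 ^ n - y) with (t / 2 ^ n) in H by ring.
      rewrite !Hhalf.
      replace (K / 4 ^ S n) with (K / 4 ^ n / 4).
      2: { simpl; field. apply pow_nonzero; lra. }
      specialize (Hs n); specialize (Ht n).
      destruct Hx as [-> | ->], Hy as [-> | ->]; repeat split; try lra; exact H. }
  destruct (nested_intervals (fun n => fst (u n)) s) as [X HX].
  { unfold s; lra. } { intros n; apply (Hu n). }
  destruct (nested_intervals (fun n => snd (u n)) t) as [Y HY].
  { unfold t; lra. } { intros n; apply (Hu n). }
  set (p := (X, Y) : C).
  destruct (Hf p) as [l Hl].
  { destruct (Hu 0%nat) as [(H1 & H2 & _) _]. specialize (HX 0%nat); specialize (HY 0%nat).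
    split; simpl in *; lra. }
  set (A := s + t).
  assert (HA : 0 <= A) by (unfold A, s, t; lra).
  (* The final estimate reads K <= 4 A^2 times this value, which is less than K / 2; the + 1 keeps
     the denominator positive for a degenerate rectangle. *)
  destruct (proj1 (is_cderive_iff f p l) Hl (K / (8 * A ^ 2 + 1))) as [r [Hr Hd]].
  { apply Rdiv_lt_0_compat; [exact HK|]. nra. }
  (* Points of the n-th rectangle are within A / 2^n of [p], hence in the disc where the tangent
     estimate holds. *)
  assert (exists n, A / 2 ^ n < r) as [n Hn].
  { destruct (pow_lt_1_zero (1/2) ltac:(rewrite Rabs_pos_eq; lra) (r / (A + 1))) as [n Hn].
    { apply Rdiv_lt_0_compat; lra. }
    exists n. specialize (Hn n (Nat.le_refl _)).
    rewrite Rabs_pos_eq in Hn by (apply pow_le; lra).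
    replace ((1 / 2) ^ n) with (1 / 2 ^ n) in Hn
      by (unfold Rdiv; rewrite Rpow_mult_distr, pow1, pow_inv; reflexivity).
    assert (0 < 1 / 2 ^ n) by (apply Rdiv_lt_0_compat; [lra | apply Hp]).
    apply (Rmult_lt_compat_r (A + 1)) in Hn; [|lra].
    replace (r / (A + 1) * (A + 1)) with r in Hn by (field; lra).
    replace (A / 2 ^ n) with (A * (1 / 2 ^ n)) by (field; specialize (Hp n); lra).
    nra. }
  destruct (Hu n) as [(H1 & H2 & H3) _].
  specialize (HX n); specialize (HY n); simpl in HX, HY.
  set (x := fst (u n)) in *. set (y := snd (u n)) in *.
  set (sn := s / 2 ^ n) in *. set (tn := t / 2 ^ n) in *.
  assert (Hsn := Hs n). assert (Htn := Ht n). fold sn in Hsn. fold tn in Htn.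
  assert (HAn : A / 2 ^ n = sn + tn) by (unfold A, sn, tn; field; specialize (Hp n); lra).
  assert (E : RectInt f x (x + sn) y (y + tn) =
    RectInt (fun z => f z - (f p - l * p + l * z))%C x (x + sn) y (y + tn)).
  { rewrite RectInt_minus; try lra.
    - rewrite RectInt_affine by lra. ring.
    - intros z [[Hz1 Hz2] _]. apply Hc. split; lra.
    - intros z _. apply continuous_Cplus; [apply continuous_const|].
      apply continuous_Cmult; [apply continuous_const | apply continuous_id]. }
  rewrite E in H3. clear E.
  assert (B : Cmod (RectInt (fun z => f z - (f p - l * p + l * z))%C x (x + sn) y (y + tn))
     <= 4 * ((x + sn - x) + (y + tn - y)) * (K / (8 * A ^ 2 + 1) * (A / 2 ^ n))).
  { apply RectInt_bound; try lra.
    - intros z [[Hz1 Hz2] _]. apply continuous_Cminus; [apply Hc; split; lra|].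
      apply continuous_Cplus; [apply continuous_const|].
      apply continuous_Cmult; [apply continuous_const | apply continuous_id].
    - intros z [[Hz1 Hz2] _].
      assert (Hzp : Cmod (z - p) <= A / 2 ^ n).
      { eapply Rle_trans; [apply Cmod_le_Rabs|]. rewrite HAn. simpl.
        apply Rplus_le_compat; apply Rabs_le; lra. }
      replace (f z - (f p - l * p + l * z))%C with (f z - f p - (z - p) * l)%C by ring.
      eapply Rle_trans; [apply Hd; lra|].
      apply Rmult_le_compat_l; [|exact Hzp].
      left; apply Rdiv_lt_0_compat; [exact HK|]. nra. }
  assert (F : K / 4 ^ n <= 4 * (A / 2 ^ n) * (K / (8 * A ^ 2 + 1) * (A / 2 ^ n))).
  { eapply Rle_trans; [exact H3|]. eapply Rle_trans; [exact B|].
    right. rewrite HAn. ring. }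
  replace (4 ^ n) with (2 ^ n * 2 ^ n) in F by (rewrite <- Rpow_mult_distr; f_equal; lra).
  specialize (Hp n).
  assert (F2 : K <= 4 * A ^ 2 * (K / (8 * A ^ 2 + 1))).
  { apply (Rmult_le_compat_r (2 ^ n * 2 ^ n)) in F; [|nra].
    replace (K / (2 ^ n * 2 ^ n) * (2 ^ n * 2 ^ n)) with K in F by (field; lra).
    eapply Rle_trans; [exact F|]. right. field. split; nra. }
  apply (Rmult_le_compat_r (8 * A ^ 2 + 1)) in F2; [|nra].
  replace (4 * A ^ 2 * (K / (8 * A ^ 2 + 1)) * (8 * A ^ 2 + 1)) with (4 * A ^ 2 * K) in F2 by (field; nra).
  nra.
Qed.

(** * Cauchy's formula and holomorphy of the derivative *)

(** The product and chain rules view [C] as a normed module over its own absolute ring; only the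
    packaging differs, and the limit condition carries over by conversion. *)
Lemma is_cderive_AbsRing (f : C -> C) (z l : C) :
  is_cderive f z l <-> is_derive (K := C_AbsRing) (V := AbsRing_NormedModule C_AbsRing) f z l.
Proof.
  split; intros [_ H]; (split; [apply is_linear_scal_l | exact H]).
Qed.

Lemma is_cderive_mult (f g : C -> C) (z l m : C) :
  is_cderive f z l -> is_cderive g z m ->
  is_cderive (fun w => f w * g w)%C z (l * g z + f z * m)%C.
Proof.
  rewrite !is_cderive_AbsRing. intros Hf Hg.
  exact (is_derive_mult (K := C_AbsRing) f g z l m Hf Hg Cmult_comm).
Qed.

Lemma is_cderive_Cinv (z : C) : z <> 0%C -> is_cderive Cinv z (- (/ z * / z))%C.
Proof.
  intros Hz. assert (Hp := proj1 (Cmod_gt_0 z) Hz).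
  apply is_cderive_iff. intros e He.
  set (m := Cmod z) in *.
  (* The remainder is (w - z)^2 / (z^2 w). The first bound gives |w| >= m / 2, so the remainder is
     at most 2 |w - z|^2 / m^3, and the second bound makes this at most e |w - z|. *)
  exists (Rmin (m / 2) (e * m ^ 3 / 2)). split.
  { apply Rmin_pos; [lra|]. assert (0 < m ^ 3) by (apply pow_lt; lra). nra. }
  intros w Hw.
  assert (Hw1 : Cmod (w - z) < m / 2) by (eapply Rlt_le_trans; [exact Hw | apply Rmin_l]).
  assert (Hw2 : Cmod (w - z) < e * m ^ 3 / 2) by (eapply Rlt_le_trans; [exact Hw | apply Rmin_r]).
  assert (Hmw : m / 2 <= Cmod w).
  { generalize (Cmod_triangle w (- (w - z))). rewrite Cmod_opp.
    replace (w + - (w - z))%C with z by ring. fold m. lra. }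
  assert (Hw0 : w <> 0%C) by (intros E; rewrite E, Cmod_0 in Hmw; lra).
  replace (/ w - / z - (w - z) * - (/ z * / z))%C
    with ((w - z) * (w - z) * (/ z * / z * / w))%C by (field; auto).
  rewrite !Cmod_mult, !Cmod_inv by assumption. fold m.
  assert (H0 := Cmod_ge_0 (w - z)).
  assert (Hi : / Cmod w <= 2 / m).
  { replace (2 / m) with (/ (m / 2)) by (field; lra). apply Rinv_le_contravar; lra. }
  assert (Hi0 : 0 < / Cmod w) by (apply Rinv_0_lt_compat; lra).
  rewrite (Rmult_assoc (Cmod (w - z))), (Rmult_comm e).
  apply Rmult_le_compat_l; [exact H0|].
  apply Rle_trans with (e * m ^ 3 / 2 * (/ m * / m * (2 / m))).
  - assert (0 < / m) by (apply Rinv_0_lt_compat; lra).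
    apply Rmult_le_compat; try lra; try nra.
  - right. field. lra.
Qed.

Lemma is_cderive_inv (f : C -> C) (z l : C) : f z <> 0%C ->
  is_cderive f z l -> is_cderive (fun w => / f w)%C z (- (l * (/ f z * / f z)))%C.
Proof.
  intros H0 Hf.
  replace (- (l * (/ f z * / f z)))%C with (l * (- (/ f z * / f z)))%C by ring.
  apply (is_derive_comp (K := C_AbsRing) (V := C_NormedModule) Cinv f).
  - apply is_cderive_Cinv, H0.
  - apply is_cderive_AbsRing, Hf.
Qed.

Lemma ex_cderive_mult (f g : C -> C) (z : C) :
  ex_cderive f z -> ex_cderive g z -> ex_cderive (fun w => f w * g w)%C z.
Proof. intros [l Hl] [m Hm]. eexists. apply is_cderive_mult; eassumption. Qed.

Lemma ex_cderive_inv (f : C -> C) (z : C) : f z <> 0%C ->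
  ex_cderive f z -> ex_cderive (fun w => / f w)%C z.
Proof. intros H [l Hl]. eexists. apply is_cderive_inv; eassumption. Qed.

Lemma ex_cderive_minus (f g : C -> C) (z : C) :
  ex_cderive f z -> ex_cderive g z -> ex_cderive (fun w => f w - g w)%C z.
Proof. apply (ex_derive_minus (K := C_AbsRing) (V := C_NormedModule)). Qed.

Lemma ex_cderive_const (k z : C) : ex_cderive (fun _ => k) z.
Proof. apply (ex_derive_const (K := C_AbsRing) (V := C_NormedModule)). Qed.

Lemma ex_cderive_id (z : C) : ex_cderive (fun w => w) z.
Proof.
  exists (RtoC 1). apply is_cderive_AbsRing.
  apply (is_derive_id (K := C_AbsRing)).
Qed.

(* Splitting off a square of side [2 e] around [p] leaves four rectangles on
   which Goursat's theorem applies; the integral over the square is [O(e)]. *)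
Lemma Goursat_punctured (f : C -> C) (a b c d : R) (p : C) (r M : R) :
  a < fst p < b -> c < snd p < d -> 0 < r ->
  (forall z, rectangle a b c d z -> z <> p -> ex_cderive f z) ->
  (forall z, Cmod (z - p) < r -> z <> p -> Cmod (f z) <= M) ->
  RectInt f a b c d = 0%C.
Proof.
  destruct p as [x y]; simpl fst; simpl snd. intros Hx Hy Hr Hf HM.
  assert (Hc : forall u v, a <= u <= b -> c <= v <= d -> u <> x \/ v <> y -> ccontinuous f (u, v)).
  { intros u v Hu Hv Hne. apply ex_cderive_continuous, Hf; [split; assumption|].
    intros E; injection E; intros; tauto. }
  assert (HG : forall a' b' c' d', a <= a' <= b' -> b' <= b -> c <= c' <= d' -> d' <= d ->
     (b' < x \/ x < a' \/ d' < y \/ y < c') -> RectInt f a' b' c' d' = 0%C).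
  { intros a' b' c' d' H1 H2 H3 H4 Hne. apply Goursat; try lra.
    intros z [Hz1 Hz2]. apply Hf; [split; lra|]. intros ->; simpl in *; lra. }
  assert (Hsmall : forall e, 0 < e -> a < x - e -> x + e < b -> c < y - e -> y + e < d ->
     2 * e < r -> Cmod (RectInt f a b c d) <= 16 * M * e).
  { intros e He H1 H2 H3 H4 H5.
    assert (E : RectInt f a b c d = RectInt f (x - e) (x + e) (y - e) (y + e)).
    { rewrite (RectInt_split_vertical f a (x - e) b c d); try lra.
      2: intros u Hu; split; apply Hc; lra.
      rewrite (HG a (x - e)); try lra.
      rewrite (RectInt_split_vertical f (x - e) (x + e) b c d); try lra.
      2: intros u Hu; split; apply Hc; lra.
      rewrite (HG (x + e) b); try lra.
      rewrite (RectInt_split_horizontal f (x - e) (x + e) c (y - e) d); try lra.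
      2: intros u Hu; split; apply Hc; lra.
      rewrite (HG (x - e) (x + e) c (y - e)); try lra.
      rewrite (RectInt_split_horizontal f (x - e) (x + e) (y - e) (y + e) d); try lra.
      2: intros u Hu; split; apply Hc; lra.
      rewrite (HG (x - e) (x + e) (y + e) d); try lra.
      ring. }
    rewrite E. eapply Rle_trans; [apply RectInt_bound with (M := M)|].
    - lra.
    - lra.
    - intros [u v] [[Hu Hv] Hb]; simpl in *. apply Hc; lra.
    - intros [u v] [[Hu Hv] Hb]; simpl in *. apply HM.
      + eapply Rle_lt_trans; [apply Cmod_le_Rabs|]. simpl.
        apply Rle_lt_trans with (e + e); [|lra].
        apply Rplus_le_compat; apply Rabs_le; lra.
      + intros E'; injection E'; intros; lra.
    - right; ring. }
  apply Cmod_eq_0. set (K := Cmod (RectInt f a b c d)) in *.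
  destruct (Rle_lt_or_eq_dec 0 K (Cmod_ge_0 _)) as [HK|HK]; [exfalso | now symmetry].
  set (m := Rmin (Rmin (x - a) (b - x)) (Rmin (Rmin (y - c) (d - y)) r)).
  assert (Hm : 0 < m) by (unfold m; repeat apply Rmin_pos; lra).
  assert (Hm' : m <= x - a /\ m <= b - x /\ m <= y - c /\ m <= d - y /\ m <= r).
  { generalize (Rmin_l (Rmin (x - a) (b - x)) (Rmin (Rmin (y - c) (d - y)) r))
      (Rmin_r (Rmin (x - a) (b - x)) (Rmin (Rmin (y - c) (d - y)) r))
      (Rmin_l (x - a) (b - x)) (Rmin_r (x - a) (b - x))
      (Rmin_l (Rmin (y - c) (d - y)) r) (Rmin_r (Rmin (y - c) (d - y)) r)
      (Rmin_l (y - c) (d - y)) (Rmin_r (y - c) (d - y)).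
    fold m. lra. }
  set (N := Rabs M + 1).
  assert (HN : 0 < N /\ M <= N) by (unfold N; generalize (Rabs_pos M) (Rle_abs M); lra).
  (* The bound m / 4 keeps the square inside the rectangle and 2 e below r; K / (32 N) brings 16 M e
     down to at most K / 2. *)
  set (e := Rmin (m / 4) (K / (32 * N))).
  assert (He : 0 < e).
  { unfold e; apply Rmin_pos; [lra|]. apply Rdiv_lt_0_compat; lra. }
  assert (He1 : e <= m / 4) by apply Rmin_l.
  assert (He2 : e <= K / (32 * N)) by apply Rmin_r.
  assert (HH : K <= 16 * M * e) by (apply Hsmall; lra).
  assert (16 * M * e <= 16 * N * (K / (32 * N))).
  { apply Rle_trans with (16 * N * e); [nra|]. apply Rmult_le_compat_l; lra. }
  replace (16 * N * (K / (32 * N))) with (K / 2) in H by (field; lra). lra.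
Qed.

Lemma Csub_neq_0 (w z : C) : w <> z -> (w - z)%C <> 0%C.
Proof. intros Hne E. apply Hne. replace w with ((w - z) + z)%C by ring. rewrite E; ring. Qed.

Lemma ccontinuous_cauchy_kernel (f : C -> C) (z w : C) :
  w <> z -> ccontinuous f w -> ccontinuous (fun s => f s * / (s - z))%C w.
Proof.
  intros Hne Hf. apply continuous_Cmult; [exact Hf|]. apply continuous_Cinv.
  - apply Csub_neq_0, Hne.
  - apply continuous_Cminus; [apply continuous_id | apply continuous_const].
Qed.

Lemma boundary_neq (a b c d : R) (p z : C) : a < fst p < b -> c < snd p < d ->
  rectangle_boundary a b c d z -> z <> p.
Proof. intros Hx Hy [_ Hb] ->. lra. Qed.

(** The difference of the integrands is the difference quotient of [f] at [p], bounded near [p] by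
    differentiability, so the punctured form of Goursat's theorem applies. The factor 1 keeps the
    last integral in the form of the Cauchy integral of the constant function 1. *)
Lemma Cauchy_formula (f : C -> C) (a b c d : R) (p : C) :
  a < fst p < b -> c < snd p < d ->
  (forall z, rectangle a b c d z -> ex_cderive f z) ->
  RectInt (fun z => f z * / (z - p))%C a b c d =
  (f p * RectInt (fun z => 1 * / (z - p))%C a b c d)%C.
Proof.
  intros Hx Hy Hf.
  assert (Hne := boundary_neq a b c d p).
  rewrite <- RectInt_scal; try lra.
  2: { intros z Hz. apply ccontinuous_cauchy_kernel; [auto | apply continuous_const]. }
  assert (E : RectInt (fun z => f z * / (z - p) - f p * (1 * / (z - p)))%C a b c d = 0%C).
  { destruct (Hf p) as [l Hl]; [split; lra|].
    destruct (proj1 (is_cderive_iff _ _ _) Hl 1 Rlt_0_1) as [r [Hr Hd]].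
    apply (Goursat_punctured _ a b c d p r (1 + Cmod l)); auto.
    - intros z Hz Hzp.
      assert (Hinv : ex_cderive (fun z => / (z - p))%C z).
      { apply ex_cderive_inv; [apply Csub_neq_0; auto|].
        apply ex_cderive_minus; [apply ex_cderive_id | apply ex_cderive_const]. }
      apply ex_cderive_minus; [apply ex_cderive_mult; auto|].
      apply ex_cderive_mult; [apply ex_cderive_const|].
      apply ex_cderive_mult; [apply ex_cderive_const | exact Hinv].
    - intros z Hz Hzp. apply Csub_neq_0 in Hzp.
      replace (f z * / (z - p) - f p * (1 * / (z - p)))%C
        with ((f z - f p - (z - p) * l) * / (z - p) + l)%C by (field; exact Hzp).
      eapply Rle_trans; [apply Cmod_triangle|].
      apply Rplus_le_compat_r. rewrite Cmod_mult, Cmod_inv by exact Hzp.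
      assert (Hq := proj1 (Cmod_gt_0 _) Hzp).
      apply (Rmult_le_reg_r (Cmod (z - p))); [exact Hq|].
      rewrite Rmult_assoc, Rinv_l, Rmult_1_r by lra. auto. }
  rewrite RectInt_minus in E; try lra.
  - match type of E with (?u - ?v)%C = _ =>
      replace u with ((u - v) + v)%C by ring end. rewrite E; ring.
  - intros z Hz. apply ccontinuous_cauchy_kernel; [auto|].
    apply ex_cderive_continuous, Hf, Hz.
  - intros z Hz. apply continuous_Cmult; [apply continuous_const|].
    apply ccontinuous_cauchy_kernel; [auto | apply continuous_const].
Qed.

(* The imaginary part is a sum of four integrals of positive functions. *)
Lemma RectInt_inv_neq_0 (a b c d : R) (p : C) :
  a < fst p < b -> c < snd p < d ->
  RectInt (fun z => 1 * / (z - p))%C a b c d <> 0%C.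
Proof.
  destruct p as [x y]; simpl fst; simpl snd. intros Hx Hy.
  destruct (continuous_edges a b c d (fun z => 1 * / (z - (x, y)))%C) as (F1 & F2 & F3 & F4);
    try lra.
  { intros z Hz. apply ccontinuous_cauchy_kernel; [|apply continuous_const].
    apply (boundary_neq a b c d); auto. }
  assert (G : forall u v, 0 < u \/ 0 < v \/ u < 0 \/ v < 0 -> 0 < / (u * (u * 1) + v * (v * 1))).
  { intros u v H. apply Rinv_0_lt_compat. nra. }
  (* Signs: z - p points downwards on the bottom edge, upwards on the top one, to the right and to
     the left on the other two; inversion flips the sign of the imaginary part and keeps that of the
     real part. *)
  assert (P1 : 0 < RInt (fun t => snd (1 * / ((t, c) - (x, y)))%C) a b).
  { apply RInt_gt_0; [lra| |].
    - intros t Ht. simpl. unfold Rdiv. assert (K := G (t + - x) (c + - y) ltac:(lra)). nra.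
    - intros t Ht. exact (proj2 (proj1 (continuous_C_iff _ t) (F1 t Ht))). }
  assert (P2 : 0 < RInt (fun t => - snd (1 * / ((t, d) - (x, y)))%C) a b).
  { apply RInt_gt_0; [lra| |].
    - intros t Ht. simpl. unfold Rdiv. assert (K := G (t + - x) (d + - y) ltac:(lra)). nra.
    - intros t Ht. apply (continuous_opp (V := R_NormedModule)).
      exact (proj2 (proj1 (continuous_C_iff _ t) (F2 t Ht))). }
  assert (P3 : 0 < RInt (fun t => fst (1 * / ((b, t) - (x, y)))%C) c d).
  { apply RInt_gt_0; [lra| |].
    - intros t Ht. simpl. unfold Rdiv. assert (K := G (b + - x) (t + - y) ltac:(lra)). nra.
    - intros t Ht. exact (proj1 (proj1 (continuous_C_iff _ t) (F3 t Ht))). }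
  assert (P4 : 0 < RInt (fun t => - fst (1 * / ((a, t) - (x, y)))%C) c d).
  { apply RInt_gt_0; [lra| |].
    - intros t Ht. simpl. unfold Rdiv. assert (K := G (a + - x) (t + - y) ltac:(lra)). nra.
    - intros t Ht. apply (continuous_opp (V := R_NormedModule)).
      exact (proj1 (proj1 (continuous_C_iff _ t) (F4 t Ht))). }
  rewrite (RInt_opp (V := R_CompleteNormedModule)) in P2 by (apply ex_RInt_snd; [lra|exact F2]).
  rewrite (RInt_opp (V := R_CompleteNormedModule)) in P4 by (apply ex_RInt_fst; [lra|exact F4]).
  change (0 < - RInt (fun t => snd (1 * / ((t, d) - (x, y)))%C) a b) in P2.
  change (0 < - RInt (fun t => fst (1 * / ((a, t) - (x, y)))%C) c d) in P4.
  intros E. apply (f_equal snd) in E.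
  assert (Him : forall q1 q2 q3 q4 : C, snd (q1 - q2 + Ci * (q3 - q4))%C
            = snd q1 - snd q2 + (fst q3 - fst q4)) by (intros; simpl; ring).
  unfold RectInt in E. rewrite Him in E. unfold CInt in E. cbn [fst snd RtoC] in E. lra.
Qed.

(** * Differentiation of Cauchy integrals *)

(** The remainder is quadratic in z - p uniformly in [w]. Integrated over the boundary it is at most
    N |z - p|^2, hence at most e |z - p| once |z - p| < e / (N + 1). *)
Lemma is_cderive_RectInt (k : C -> C -> C) (k1 : C -> C) (a b c d : R) (p : C) (r M : R) :
  a <= b -> c <= d -> 0 < r ->
  (forall z w, Cmod (z - p) < r -> rectangle_boundary a b c d w -> ccontinuous (k z) w) ->
  (forall w, rectangle_boundary a b c d w -> ccontinuous k1 w) ->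
  (forall z w, Cmod (z - p) < r -> rectangle_boundary a b c d w ->
     Cmod (k z w - k p w - (z - p) * k1 w) <= M * Cmod (z - p) ^ 2) ->
  is_cderive (fun z => RectInt (k z) a b c d) p (RectInt k1 a b c d).
Proof.
  intros Hab Hcd Hr Hk Hk1 HM.
  apply is_cderive_iff. intros e He.
  set (N := 4 * ((b - a) + (d - c)) * (Rabs M + 1)).
  assert (HM0 : 0 <= Rabs M) by apply Rabs_pos.
  assert (HMa := Rle_abs M).
  assert (HN : 0 <= N) by (unfold N; nra).
  exists (Rmin r (e / (N + 1))). split.
  { apply Rmin_pos; [exact Hr|]. apply Rdiv_lt_0_compat; lra. }
  intros z Hz.
  assert (Hz1 : Cmod (z - p) < r) by (eapply Rlt_le_trans; [exact Hz | apply Rmin_l]).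
  assert (Hz2 : Cmod (z - p) < e / (N + 1)) by (eapply Rlt_le_trans; [exact Hz | apply Rmin_r]).
  assert (Hp : Cmod (p - p) < r) by (replace (p - p)%C with (0 : C) by ring; rewrite Cmod_0; exact Hr).
  rewrite <- RectInt_scal, <- !RectInt_minus; auto.
  - apply Rle_trans with (N * (Cmod (z - p) * Cmod (z - p))).
    + unfold N. rewrite Rmult_assoc. apply RectInt_bound; auto.
      * intros w Hw. apply continuous_Cminus; [apply continuous_Cminus; auto|].
        apply continuous_Cmult; [apply continuous_const | auto].
      * intros w Hw. eapply Rle_trans; [apply HM; auto|]. 
        replace (Cmod (z - p) ^ 2) with (Cmod (z - p) * Cmod (z - p)) by ring.
        apply Rmult_le_compat_r; [|lra]. apply Rmult_le_pos; apply Cmod_ge_0.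
    + rewrite <- Rmult_assoc. apply Rmult_le_compat_r; [apply Cmod_ge_0|].
      apply Rmult_lt_compat_r with (r := N + 1) in Hz2; [|lra].
      replace (e / (N + 1) * (N + 1)) with e in Hz2 by (field; lra).
      assert (H0 := Cmod_ge_0 (z - p)). nra.
  - intros w Hw. apply continuous_Cminus; auto.
  - intros w Hw. apply continuous_Cmult; [apply continuous_const | auto].
Qed.

Lemma continuous_seg_bounded (g : R -> C) (a b : R) : a <= b -> continuous_seg g a b ->
  exists M, forall t, a <= t <= b -> Cmod (g t) <= M.
Proof.
  intros Hab Hg.
  destruct (continuity_ab_maj (fun t => fst (g t) * fst (g t) + snd (g t) * snd (g t)) a b Hab)
    as [m [Hm _]].
  { intros t Ht. apply continuity_pt_filterlim.
    destruct (proj1 (continuous_C_iff g t) (Hg t Ht)) as [H1 H2].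
    apply (continuous_plus (V := R_NormedModule) (fun t => fst (g t) * fst (g t)) (fun t => snd (g t) * snd (g t)));
      apply (continuous_mult (K := R_AbsRing)); assumption. }
  eexists. intros t Ht. specialize (Hm t Ht). simpl in Hm.
  (* The squared modulus attains a maximum, and x <= 1 + x^2 turns it into a bound of the
     modulus. *)
  eapply Rle_trans; [|apply Rplus_le_compat_l with (r := 1); exact Hm].
  assert (H := Cmod_ge_0 (g t)).
  assert (E : Cmod (g t) * Cmod (g t) = fst (g t) * fst (g t) + snd (g t) * snd (g t)).
  { unfold Cmod. rewrite sqrt_sqrt; nra. }
  nra.
Qed.

Lemma boundary_bounded (f : C -> C) (a b c d : R) : a <= b -> c <= d ->
  (forall z, rectangle_boundary a b c d z -> ccontinuous f z) ->
  exists M, forall z, rectangle_boundary a b c d z -> Cmod (f z) <= M.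
Proof.
  intros Hab Hcd Hf.
  destruct (continuous_edges a b c d f Hab Hcd Hf) as (F1 & F2 & F3 & F4).
  apply continuous_seg_bounded in F1, F2, F3, F4; auto.
  destruct F1 as [M1 F1], F2 as [M2 F2], F3 as [M3 F3], F4 as [M4 F4].
  exists (Rmax (Rmax M1 M2) (Rmax M3 M4)).
  intros [x y] [[Hx Hy] Hb]; simpl in *.
  destruct Hb as [-> | [-> | [-> | ->]]].
  - eapply Rle_trans; [apply F4; auto|]. eapply Rle_trans; [apply Rmax_r | apply Rmax_r].
  - eapply Rle_trans; [apply F3; auto|]. eapply Rle_trans; [apply Rmax_l | apply Rmax_r].
  - eapply Rle_trans; [apply F1; auto|]. eapply Rle_trans; [apply Rmax_l | apply Rmax_l].
  - eapply Rle_trans; [apply F2; auto|]. eapply Rle_trans; [apply Rmax_r | apply Rmax_l].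
Qed.

(** The factor 2 leaves room: every [z] within r of [p] is still at distance at least r from the
    boundary. *)
Lemma boundary_distance (a b c d : R) (p : C) : a < fst p < b -> c < snd p < d ->
  exists r, 0 < r /\ forall w, rectangle_boundary a b c d w -> 2 * r <= Cmod (w - p).
Proof.
  intros Hx Hy.
  exists (Rmin (Rmin (fst p - a) (b - fst p)) (Rmin (snd p - c) (d - snd p)) / 2). split.
  { apply Rdiv_lt_0_compat; [|lra]. repeat apply Rmin_pos; lra. }
  intros w [_ Hb].
  match goal with |- 2 * (?m / 2) <= _ => replace (2 * (m / 2)) with m by field end.
  assert (H1 := Rabs_fst_le_Cmod (w - p)). assert (H2 := Rabs_snd_le_Cmod (w - p)).
  simpl in H1, H2.
  destruct Hb as [E | [E | [E | E]]]; rewrite E in *.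
  - eapply Rle_trans; [|exact H1]. eapply Rle_trans; [apply Rmin_l|].
    eapply Rle_trans; [apply Rmin_l|]. rewrite Rabs_left; lra.
  - eapply Rle_trans; [|exact H1]. eapply Rle_trans; [apply Rmin_l|].
    eapply Rle_trans; [apply Rmin_r|]. rewrite Rabs_pos_eq; lra.
  - eapply Rle_trans; [|exact H2]. eapply Rle_trans; [apply Rmin_r|].
    eapply Rle_trans; [apply Rmin_l|]. rewrite Rabs_left; lra.
  - eapply Rle_trans; [|exact H2]. eapply Rle_trans; [apply Rmin_r|].
    eapply Rle_trans; [apply Rmin_r|]. rewrite Rabs_pos_eq; lra.
Qed.

(* With [u = 1/(w-z)], [v = 1/(w-p)] and [h = z - p] one has [u - v = h u v],
   whence [u - v - h v^2 = h^2 u v^2] and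
   [u^2 - v^2 - 2 h v^3 = h^2 u v^2 (u + 2 v)]. *)
Lemma is_cderive_Cauchy_integral (f : C -> C) (a b c d : R) (p : C) :
  a < fst p < b -> c < snd p < d ->
  (forall z, rectangle_boundary a b c d z -> ccontinuous f z) ->
  is_cderive (fun z => RectInt (fun w => f w * / (w - z))%C a b c d) p
    (RectInt (fun w => f w * / (w - p) * / (w - p))%C a b c d) /\
  ex_cderive (fun z => RectInt (fun w => f w * / (w - z) * / (w - z))%C a b c d) p.
Proof.
  intros Hx Hy Hf.
  destruct (boundary_bounded f a b c d) as [M HM]; try lra; auto.
  destruct (boundary_distance a b c d p Hx Hy) as [r [Hr Hdist]].
  set (B := / r).
  assert (HB : 0 < B) by (apply Rinv_0_lt_compat, Hr).
  assert (Hfar : forall z w, Cmod (z - p) < r -> rectangle_boundary a b c d w -> r <= Cmod (w - z)).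
  { intros z w Hz Hw. specialize (Hdist w Hw).
    generalize (Cmod_triangle (w - z) (z - p)).
    replace (w - z + (z - p))%C with (w - p)%C by ring. lra. }
  assert (Hn0 : forall z w, Cmod (z - p) < r -> rectangle_boundary a b c d w -> (w - z)%C <> 0%C).
  { intros z w Hz Hw E. specialize (Hfar z w Hz Hw). rewrite E, Cmod_0 in Hfar. lra. }
  assert (Hne : forall z w, Cmod (z - p) < r -> rectangle_boundary a b c d w -> w <> z).
  { intros z w Hz Hw ->. apply (Hn0 z z Hz Hw). ring. }
  assert (HuB : forall z w, Cmod (z - p) < r -> rectangle_boundary a b c d w ->
                 Cmod (/ (w - z)) <= B).
  { intros z w Hz Hw. rewrite Cmod_inv by auto. apply Rinv_le_contravar; auto. }
  assert (Hp : Cmod (p - p) < r) by (replace (p - p)%C with (0 : C) by ring; rewrite Cmod_0; exact Hr).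
  split; [|eexists].
  - apply is_cderive_RectInt with (r := r) (M := M * (B * (B * B))); try lra.
    + intros z w Hz Hw. apply ccontinuous_cauchy_kernel; auto.
    + intros w Hw. apply ccontinuous_cauchy_kernel; [|apply ccontinuous_cauchy_kernel]; auto.
    + intros z w Hz Hw.
      replace (f w * / (w - z) - f w * / (w - p) - (z - p) * (f w * / (w - p) * / (w - p)))%C
        with (f w * (/ (w - z) * (/ (w - p) * / (w - p))) * ((z - p) * (z - p)))%C
        by (field; auto).
      rewrite !Cmod_mult.
      replace (Cmod (z - p) ^ 2) with (Cmod (z - p) * Cmod (z - p)) by ring.
      apply Rmult_le_compat_r; [apply Rmult_le_pos; apply Cmod_ge_0|].
      repeat (apply Rmult_le_compat; auto using Cmod_ge_0, Rmult_le_pos).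
  - apply is_cderive_RectInt with (r := r) (M := M * (B * (B * B) * (B + 2 * B)))
      (k1 := fun w => (2 * (f w * / (w - p) * / (w - p) * / (w - p)))%C); try lra.
    + intros z w Hz Hw. apply ccontinuous_cauchy_kernel; [|apply ccontinuous_cauchy_kernel]; auto.
    + intros w Hw. apply continuous_Cmult; [apply continuous_const|].
      apply ccontinuous_cauchy_kernel; [|apply ccontinuous_cauchy_kernel; [|apply ccontinuous_cauchy_kernel]]; auto.
    + intros z w Hz Hw.
      replace (f w * / (w - z) * / (w - z) - f w * / (w - p) * / (w - p)
                - (z - p) * (2 * (f w * / (w - p) * / (w - p) * / (w - p))))%C
        with (f w * (/ (w - z) * (/ (w - p) * / (w - p)) * (/ (w - z) + 2 * / (w - p)))
                * ((z - p) * (z - p)))%C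
        by (field; auto).
      assert (HS : Cmod (/ (w - z) + 2 * / (w - p)) <= B + 2 * B).
      { eapply Rle_trans; [apply Cmod_triangle|]. rewrite Cmod_mult, Cmod_R, Rabs_pos_eq by lra.
        apply Rplus_le_compat; auto. apply Rmult_le_compat_l; [lra|auto]. }
      rewrite !Cmod_mult.
      replace (Cmod (z - p) ^ 2) with (Cmod (z - p) * Cmod (z - p)) by ring.
      apply Rmult_le_compat_r; [apply Rmult_le_pos; apply Cmod_ge_0|].
      repeat (apply Rmult_le_compat; auto using Cmod_ge_0, Rmult_le_pos).
Qed.

(** In a disc around [p], [f] is F0 / G0, the quotient of the Cauchy integrals of [f] and of 1. So
    [C_derive f] equals F1 / G0 - F0 G1 / G0^2 there, and all four functions are differentiable at
    [p]. The term with G1 stays because G0 is not shown to be constant. *)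
Theorem holomorphic_C_derive (f : C -> C) (Omega : C -> Prop) :
  open (T := C_UniformSpace) Omega -> holomorphic f Omega -> holomorphic (C_derive f) Omega.
Proof.
  intros Ho Hf p Hp.
  destruct (proj1 (locally_C_iff p Omega) (Ho p Hp)) as [r [Hr HO]].
  (* Points of the square of half side r / 3 are within 2 r / 3 of [p], hence in the disc contained
     in [Omega]. *)
  set (s := r / 3).
  set (a := fst p - s). set (b := fst p + s). set (c := snd p - s). set (d := snd p + s).
  assert (Hrect : forall z, rectangle a b c d z -> ex_cderive f z).
  { intros z [Hz1 Hz2]. apply Hf, HO.
    eapply Rle_lt_trans; [apply Cmod_le_Rabs|]. simpl.
    unfold a, b, c, d, s in *.
    apply Rle_lt_trans with (r / 3 + r / 3); [|lra].
    apply Rplus_le_compat; apply Rabs_le; lra. }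
  assert (Hc : forall z, rectangle_boundary a b c d z -> ccontinuous f z).
  { intros z [Hz _]. apply ex_cderive_continuous; auto. }
  assert (Hc1 : forall z, rectangle_boundary a b c d z -> ccontinuous (fun _ => RtoC 1) z).
  { intros z _. apply continuous_const. }
  set (F0 := fun z => RectInt (fun w => f w * / (w - z))%C a b c d).
  set (F1 := fun z => RectInt (fun w => f w * / (w - z) * / (w - z))%C a b c d).
  set (G0 := fun z => RectInt (fun w => 1 * / (w - z))%C a b c d).
  set (G1 := fun z => RectInt (fun w => 1 * / (w - z) * / (w - z))%C a b c d).
  assert (Hin : forall z, Cmod (z - p) < s -> a < fst z < b /\ c < snd z < d).
  { intros z Hz. assert (H1 := Rabs_fst_le_Cmod (z - p)). assert (H2 := Rabs_snd_le_Cmod (z - p)).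
    simpl in H1, H2. unfold a, b, c, d.
    assert (H1' := Rabs_def2 (fst z + - fst p) s ltac:(lra)).
    assert (H2' := Rabs_def2 (snd z + - snd p) s ltac:(lra)). lra. }
  assert (HG : forall z, Cmod (z - p) < s -> G0 z <> 0%C).
  { intros z Hz. destruct (Hin z Hz) as [Hz1 Hz2].
    exact (RectInt_inv_neq_0 a b c d z Hz1 Hz2). }
  assert (HFG : forall z, Cmod (z - p) < s -> (F0 z * / G0 z)%C = f z).
  { intros z Hz. destruct (Hin z Hz) as [Hz1 Hz2].
    assert (E : F0 z = (f z * G0 z)%C) by exact (Cauchy_formula f a b c d z Hz1 Hz2 Hrect).
    rewrite E, <- Cmult_assoc, Cinv_r, Cmult_1_r; auto. }
  assert (Hs : 0 < s) by (unfold s; lra).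
  assert (Hloc : forall z, Cmod (z - p) < s ->
     locally (T := AbsRing_UniformSpace C_AbsRing) z (fun w => Cmod (w - p) < s)).
  { intros z Hz. apply locally_C, locally_C_iff. exists (s - Cmod (z - p)). split; [lra|].
    intros w Hw. generalize (Cmod_triangle (w - z) (z - p)).
    replace (w - z + (z - p))%C with (w - p)%C by ring. lra. }
  assert (Hpp : Cmod (p - p) < s) by (replace (p - p)%C with (0 : C) by ring; rewrite Cmod_0; exact Hs).
  apply (ex_derive_ext_loc (K := C_AbsRing) (V := C_NormedModule)
     (fun z => F1 z * / G0 z - F0 z * (G1 z * (/ G0 z * / G0 z)))%C).
  - apply (filter_imp (fun w => Cmod (w - p) < s)); [|apply Hloc, Hpp].
    intros z Hz. symmetry. apply is_C_derive_unique.
    apply (is_derive_ext_loc (K := C_AbsRing) (V := C_NormedModule) (fun z => F0 z * / G0 z)%C).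
    { apply (filter_imp (fun w => Cmod (w - p) < s)); [exact HFG | apply Hloc, Hz]. }
    replace (F1 z * / G0 z - F0 z * (G1 z * (/ G0 z * / G0 z)))%C
      with (F1 z * / G0 z + F0 z * (- (G1 z * (/ G0 z * / G0 z))))%C by ring.
    destruct (Hin z Hz) as [Hz1 Hz2].
    exact (is_cderive_mult F0 (fun z => / G0 z)%C z _ _
      (proj1 (is_cderive_Cauchy_integral f a b c d z Hz1 Hz2 Hc))
      (is_cderive_inv G0 z _ (HG z Hz)
        (proj1 (is_cderive_Cauchy_integral (fun _ => 1%C) a b c d z Hz1 Hz2 Hc1)))).
  - destruct (Hin p Hpp) as [H1 H2].
    destruct (is_cderive_Cauchy_integral f a b c d p H1 H2 Hc) as [DF0 DF1].
    destruct (is_cderive_Cauchy_integral (fun _ => 1%C) a b c d p H1 H2 Hc1) as [DG0 DG1].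
    assert (EF0 : ex_cderive F0 p) by (eexists; exact DF0).
    assert (EG : ex_cderive (fun z => / G0 z)%C p).
    { apply (ex_cderive_inv G0 p (HG p Hpp)). eexists; exact DG0. }
    exact (ex_cderive_minus _ _ p (ex_cderive_mult F1 _ p DF1 EG)
      (ex_cderive_mult F0 _ p EF0
        (ex_cderive_mult G1 _ p DG1 (ex_cderive_mult _ _ p EG EG)))).
Qed.

Lemma holomorphic_C_derive_n (f : C -> C) (Omega : C -> Prop) (n : nat) :
  open (T := C_UniformSpace) Omega -> holomorphic f Omega -> holomorphic (C_derive_n f n) Omega.
Proof.
  intros Ho Hf. induction n as [|n IH]; [exact Hf|].
  apply holomorphic_C_derive; assumption.
Qed.

(** * Continuous extension to the closure *)

(** Here [pr] stands for the real or the imaginary part: the real mean value theorem needs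
    real-valued functions, and both cases are treated at once. *)
Lemma is_cderive_along_segment (pr : C -> R) (h : C -> C) (z w l : C) (t : R) :
  (forall u v, pr (u - v)%C = pr u - pr v) ->
  (forall k u, pr (RtoC k * u)%C = k * pr u) ->
  (forall u, Rabs (pr u) <= Cmod u) ->
  is_cderive h (RtoC (1 - t) * z + RtoC t * w)%C l ->
  is_derive (fun s => pr (h (RtoC (1 - s) * z + RtoC s * w)%C)) t (pr ((w - z) * l)%C).
Proof.
  intros Hm Hs Hb Hh. apply is_derive_Reals. intros e He.
  (* The + 1 allows division by [q] even when z = w. *)
  set (q := Cmod (w - z) + 1).
  assert (Hq : 0 < q) by (unfold q; generalize (Cmod_ge_0 (w - z)); lra).
  destruct (proj1 (is_cderive_iff _ _ _) Hh (e / (2 * q))) as [d [Hd H]].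
  { apply Rdiv_lt_0_compat; lra. }
  assert (Hdq : 0 < d / q) by (apply Rdiv_lt_0_compat; lra).
  exists (mkposreal _ Hdq). intros k Hk0 Hk. simpl in Hk.
  set (y := (RtoC (1 - t) * z + RtoC t * w)%C) in *.
  set (y' := (RtoC (1 - (t + k)) * z + RtoC (t + k) * w)%C).
  assert (E : (y' - y)%C = (RtoC k * (w - z))%C).
  { unfold y', y. rewrite !RtoC_minus, !RtoC_plus. ring. }
  assert (Hk1 : 0 < Rabs k) by (apply Rabs_pos_lt; exact Hk0).
  assert (Hy : Cmod (y' - y) <= Rabs k * q).
  { rewrite E, Cmod_mult, Cmod_R. apply Rmult_le_compat_l; [lra|]. unfold q; lra. }
  assert (Hkq : Rabs k * q < d).
  { apply (Rmult_lt_compat_r q) in Hk; [|lra].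
    replace (d / q * q) with d in Hk by (field; lra). exact Hk. }
  specialize (H y' ltac:(lra)). rewrite E in H at 1.
  replace ((pr (h y') - pr (h y)) / k - pr ((w - z) * l)%C)
    with (pr (h y' - h y - RtoC k * (w - z) * l)%C / k).
  2: { rewrite !Hm, <- Cmult_assoc, Hs. field; exact Hk0. }
  unfold Rdiv at 1. rewrite Rabs_mult, Rabs_inv.
  apply (Rmult_lt_reg_r (Rabs k)); [exact Hk1|].
  rewrite Rmult_assoc, Rinv_l, Rmult_1_r by lra.
  eapply Rle_lt_trans; [apply Hb|]. eapply Rle_lt_trans; [exact H|].
  apply Rle_lt_trans with (e / (2 * q) * (Rabs k * q)).
  - apply Rmult_le_compat_l; [|exact Hy]. left; apply Rdiv_lt_0_compat; lra.
  - replace (e / (2 * q) * (Rabs k * q)) with (e * Rabs k / 2) by (field; lra). nra.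
Qed.

(** Convexity keeps the segment inside [D], so the real mean value theorem applies along it to each
    component; the factor 2 comes from adding the two components. *)
Lemma convex_Lipschitz (D : C -> Prop) (h h' : C -> C) (M : R) : is_convex D ->
  (forall z, D z -> is_cderive h z (h' z)) -> (forall z, D z -> Cmod (h' z) <= M) ->
  forall z w, D z -> D w -> Cmod (h w - h z) <= 2 * M * Cmod (w - z).
Proof.
  intros HD Hh HM z w Hz Hw.
  assert (Hpr : forall pr : C -> R,
    (forall u v, pr (u - v)%C = pr u - pr v) ->
    (forall k u, pr (RtoC k * u)%C = k * pr u) ->
    (forall u, Rabs (pr u) <= Cmod u) ->
    Rabs (pr (h w - h z)%C) <= Cmod (w - z) * M).
  { intros pr Hm Hs Hb.
    set (y := fun t : R => (RtoC (1 - t) * z + RtoC t * w)%C).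
    assert (Hy : forall t, Rmin 0 1 <= t <= Rmax 0 1 -> D (y t)).
    { intros t. rewrite Rmin_left, Rmax_right by lra. intros Ht. apply HD; auto. }
    assert (HDer : forall t, Rmin 0 1 <= t <= Rmax 0 1 ->
       is_derive (fun s => pr (h (y s))) t (pr ((w - z) * h' (y t))%C)).
    { intros t Ht. apply is_cderive_along_segment; auto. }
    destruct (MVT_gen (fun s => pr (h (y s))) 0 1 (fun t => pr ((w - z) * h' (y t))%C))
      as [t [Ht E]].
    - intros t Ht. apply HDer; lra.
    - intros t Ht. apply continuity_pt_filterlim.
      apply (ex_derive_continuous (V := R_NormedModule)). eexists; apply HDer, Ht.
    - replace (y 1) with w in E by (unfold y; rewrite Rminus_diag; ring).
      replace (y 0) with z in E by (unfold y; rewrite Rminus_0_r; ring).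
      rewrite Hm, E, Rminus_0_r, Rmult_1_r.
      eapply Rle_trans; [apply Hb|]. rewrite Cmod_mult.
      apply Rmult_le_compat_l; [apply Cmod_ge_0 | auto]. }
  eapply Rle_trans; [apply Cmod_le_Rabs|].
  assert (H1 := Hpr fst). assert (H2 := Hpr snd).
  specialize (H1 ltac:(intros; reflexivity) ltac:(intros; simpl; ring) Rabs_fst_le_Cmod).
  specialize (H2 ltac:(intros; reflexivity) ltac:(intros; simpl; ring) Rabs_snd_le_Cmod).
  lra.
Qed.

Lemma is_convex_ball (p : C) (r : R) : is_convex (fun z => Cmod (z - p) < r).
Proof.
  intros z w t Hz Hw Ht.
  replace (RtoC (1 - t) * z + RtoC t * w - p)%C
    with (RtoC (1 - t) * (z - p) + RtoC t * (w - p))%C by (rewrite RtoC_minus; ring).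
  eapply Rle_lt_trans; [apply Cmod_triangle|].
  rewrite !Cmod_mult, !Cmod_R, !Rabs_pos_eq by lra.
  (* Strictness comes from the term in [w], which has positive weight unless t = 0. *)
  destruct (Req_dec t 0) as [->|Ht0]; [lra|]. 
  assert (t * Cmod (w - p) < t * r) by (apply Rmult_lt_compat_l; lra).
  assert ((1 - t) * Cmod (z - p) <= (1 - t) * r) by (apply Rmult_le_compat_l; lra).
  lra.
Qed.

(** * Limits at points of the closure *)

(** The point [p] is not excluded: if it lies in [A], the limit can only be [h p]. *)
Definition limit_within (A : C -> Prop) (h : C -> C) (p l : C) : Prop :=
  forall e, 0 < e -> exists d, 0 < d /\
    forall z, A z -> Cmod (z - p) < d -> Cmod (h z - l) < e.

Lemma closure_ball (A : C -> Prop) (p : C) (d : R) :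
  closure A p -> 0 < d -> exists z, A z /\ Cmod (z - p) < d.
Proof.
  intros Hp Hd. destruct (Hp (fun z => Cmod (z - p) < d)) as [z [Hz1 Hz2]].
  - apply locally_C_iff. exists d; auto.
  - exists z; auto.
Qed.

Lemma subset_closure (A : C -> Prop) (p : C) : A p -> closure A p.
Proof.
  intros Hp U [e He]. exists p; split; [|exact Hp]. apply He, ball_center.
Qed.

(** The Lipschitz bound makes the image of the trace filter at [p] Cauchy, and [C] is complete. The
    trace filter is proper because [p] lies in the closure. *)
Lemma Lipschitz_limit (A : C -> Prop) (h : C -> C) (p : C) (r K : R) :
  closure A p -> 0 < r ->
  (forall z w, A z -> A w -> Cmod (z - p) < r -> Cmod (w - p) < r ->
     Cmod (h w - h z) <= K * Cmod (w - z)) ->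
  exists l, limit_within A h p l.
Proof.
  intros Hp Hr HL.
  assert (PF : ProperFilter (within A (locally (T := C_UniformSpace) p))).
  { constructor; [|apply within_filter, locally_filter].
    intros P HP. apply locally_C_iff in HP. destruct HP as [d [Hd HP]].
    destruct (closure_ball A p d Hp Hd) as [z [Hz1 Hz2]]. exists z; auto. }
  destruct (proj1 (filterlim_locally_cauchy (U := C_CompleteNormedModule) (F := within A (locally (T := C_UniformSpace) p)) h)) as [l Hl].
  - intros e.
    set (K' := Rabs K + 1).
    assert (HK : 0 < K' /\ K <= K') by (unfold K'; generalize (Rabs_pos K) (Rle_abs K); lra).
    (* Two points of the disc of radius d are less than 2 d apart, so their images differ by less
       than e. *)
    set (d := Rmin r (e / (2 * K'))).
    assert (Hd : 0 < d).
    { apply Rmin_pos; [exact Hr|]. apply Rdiv_lt_0_compat; [apply cond_pos | lra]. }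
    exists (fun z => A z /\ Cmod (z - p) < d). split.
    + apply locally_C_iff. exists d; split; auto.
    + intros z w [Hz1 Hz2] [Hw1 Hw2]. apply C_NormedModule_mixin_compat1.
      change (Cmod (h w - h z) < e).
      assert (Hdr : d <= r) by apply Rmin_l.
      assert (Hde : d <= e / (2 * K')) by apply Rmin_r.
      assert (Hwz : Cmod (w - z) < 2 * d).
      { generalize (Cmod_triangle (w - p) (- (z - p))). rewrite Cmod_opp.
        replace (w - p + - (z - p))%C with (w - z)%C by ring. lra. }
      eapply Rle_lt_trans; [apply HL; auto; lra|].
      assert (H0 := Cmod_ge_0 (w - z)).
      apply Rle_lt_trans with (K' * Cmod (w - z)); [nra|].
      apply Rlt_le_trans with (K' * (2 * d)); [apply Rmult_lt_compat_l; lra|].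
      apply (Rmult_le_compat_l (2 * K')) in Hde; [|lra].
      replace (2 * K' * (e / (2 * K'))) with (pos e) in Hde by (field; lra). lra.
  - exists l. intros e He.
    assert (Hl' : locally (T := C_UniformSpace) p (fun z => A z -> Cmod (h z - l) < e)).
    { apply (Hl (fun y => Cmod (y - l) < e)).
      apply locally_C_iff. exists e; auto. }
    apply locally_C_iff in Hl'. destruct Hl' as [d [Hd H]]. exists d; auto.
Qed.

(** The extension takes the limit at each point of the closure, and the default 0 elsewhere. For
    continuity at [p], the value at [q] is within e / 2 of some [h z] with [z] so near [q] that
    [h z] is also within e / 2 of the value at [p]. *)
Lemma limit_within_extension (A : C -> Prop) (h : C -> C) :
  (forall p, A p -> ccontinuous h p) ->
  (forall p, closure A p -> exists l, limit_within A h p l) ->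
  has_continuous_extension h A.
Proof.
  intros Hc Hlim.
  destruct (choice (fun p l => (closure A p -> limit_within A h p l) /\ (A p -> l = h p)))
    as [g Hg].
  { intros p. destruct (classic (A p)) as [Hp|Hp].
    - exists (h p). split; [|auto]. intros _ e He.
      destruct (proj1 (ccontinuous_iff h p) (Hc p Hp) e He) as [d [Hd H]].
      exists d; auto.
    - destruct (classic (closure A p)) as [Hcl|Hcl].
      + destruct (Hlim p Hcl) as [l Hl]. exists l; tauto.
      + exists 0%C; tauto. }
  exists g. split; [|intros z Hz; apply Hg, Hz].
  intros p Hp P HP. apply locally_C_iff in HP. destruct HP as [e [He HP]].
  destruct (proj1 (Hg p) Hp (e / 2)) as [d [Hd H]]; [lra|].
  apply locally_C_iff. exists d. split; [exact Hd|].
  intros q Hq Hqcl. apply HP.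
  destruct (proj1 (Hg q) Hqcl (e / 2)) as [d' [Hd' H']]; [lra|].
  destruct (closure_ball A q (Rmin d' (d - Cmod (q - p))) Hqcl) as [z [Hz Hzq]].
  { apply Rmin_pos; lra. }
  assert (Hz1 : Cmod (z - q) < d') by (eapply Rlt_le_trans; [exact Hzq | apply Rmin_l]).
  assert (Hz2 : Cmod (z - q) < d - Cmod (q - p)) by (eapply Rlt_le_trans; [exact Hzq | apply Rmin_r]).
  specialize (H' z Hz Hz1).
  assert (Hzp : Cmod (z - p) < d).
  { generalize (Cmod_triangle (z - q) (q - p)).
    replace (z - q + (q - p))%C with (z - p)%C by ring. lra. }
  specialize (H z Hz Hzp).
  generalize (Cmod_triangle (h z - g p) (- (h z - g q))). rewrite Cmod_opp.
  replace (h z - g p + - (h z - g q))%C with (g q - g p)%C by ring. lra.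
Qed.

Lemma extension_of_derivative (Omega : C -> Prop) (h : C -> C) :
  is_convex Omega -> holomorphic h Omega ->
  has_continuous_extension (C_derive h) Omega -> has_continuous_extension h Omega.
Proof.
  intros HO Hh [g [Hg HgE]].
  apply limit_within_extension.
  { intros p Hp. apply ex_cderive_continuous, Hh, Hp. }
  intros p Hp.
  assert (Hloc : locally (T := C_UniformSpace) p
            (fun z => closure Omega z -> Cmod (g z - g p) < 1)).
  { apply (Hg p Hp (fun y => Cmod (y - g p) < 1)). apply locally_C_iff. exists 1; split; [lra | auto]. }
  apply locally_C_iff in Hloc. destruct Hloc as [r [Hr Hloc]].
  (* In the disc, |h'| = |g| is at most 1 + |g p|; the 2 is that of [convex_Lipschitz]. *)
  apply Lipschitz_limit with (r := r) (K := 2 * (1 + Cmod (g p))); auto.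
  intros z w Hz Hw Hzr Hwr.
  apply (convex_Lipschitz (fun z => Omega z /\ Cmod (z - p) < r) h (C_derive h)); auto.
  - intros u v t [Hu1 Hu2] [Hv1 Hv2] Ht. split; [apply HO | apply is_convex_ball]; auto.
  - intros u [Hu _]. apply (C_derive_correct h u 0%C), Hh, Hu.
  - intros u [Hu1 Hu2]. rewrite <- HgE by exact Hu1.
    specialize (Hloc u Hu2 (subset_closure _ _ Hu1)).
    generalize (Cmod_triangle (g u - g p) (g p)).
    replace (g u - g p + g p)%C with (g u) by ring. lra.
Qed.

(** * The index sets and the descent *)

Lemma F_tilde0_incl (F : nat -> Prop) (l : nat) : F l -> F_tilde0 F l.
Proof.
  intros Hl. apply (proj1 (Lub_Rbar_correct _)). exists l; auto.
Qed.

(** If every element of [F] were below l, then l - 1 would be an upper bound by integrality, so the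
    supremum would be less than l. Finite and infinite suprema are covered alike. *)
Lemma F_tilde0_bounded_by_element (F : nat -> Prop) (l : nat) :
  (exists m, F m) -> F_tilde0 F l -> exists m, F m /\ (l <= m)%nat.
Proof.
  intros [m0 Hm0] Hl. apply NNPP. intros Hno.
  assert (Hlt : forall m, F m -> INR m <= INR l - 1).
  { intros m Hm. destruct (Nat.le_gt_cases l m) as [H|H]; [exfalso; apply Hno; exists m; auto|].
    replace (INR l - 1) with (INR (l - 1)) by (rewrite minus_INR by lia; reflexivity).
    apply le_INR; lia. }
  assert (Hub : Rbar_le (sup_nat F) (INR l - 1)).
  { apply (proj2 (Lub_Rbar_correct _)). intros x [m [Hm ->]]. apply Hlt, Hm. }
  assert (H := Rbar_le_trans _ _ _ Hl Hub). simpl in H. lra.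
Qed.

Theorem theorem5p1 (Omega : C -> Prop) (F : nat -> Prop)
  (Omega_domain : is_domain Omega) (Omega_convex : is_convex Omega)
  (F_nonempty : exists l : nat, F l) :
  forall f : C -> C, A_space F Omega f <-> A_space (F_tilde0 F) Omega f.
Proof.
  intros f. split; intros [Hf HE]; (split; [exact Hf|]); intros l Hl.
  - destruct (F_tilde0_bounded_by_element F l F_nonempty Hl) as [m [Hm Hlm]].
    (* Membership of [m] is dropped before the induction, as the intermediate indices between l and
       [m] may lie outside [F]. *)
    specialize (HE m Hm). clear Hm.
    induction Hlm as [|m Hlm IH]; [exact HE|].
    apply IH, extension_of_derivative; auto.
    apply holomorphic_C_derive_n; [apply Omega_domain | exact Hf].
  - apply HE, F_tilde0_incl, Hl.
Qed.
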